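(* Let $F:\{0,1\}^3\to\mathbb{Q}_{\ge0}$. The following are equivalent: (1) $F$ is windable; (2) for all $x_1,x_2,x_3\in\{0,1\}$, $F(x_1,x_2,x_3)F(1-x_1,1-x_2,1-x_3)\le F(x_1,x_2,1-x_3)F(1-x_1,1-x_2,x_3)+F(x_1,1-x_2,x_3)F(1-x_1,x_2,1-x_3)+F(x_1,1-x_2,1-x_3)F(1-x_1,x_2,x_3)$; (3) $F$ has a matchings circuit.
   Context: For $x,y\in\{0,1\}^J$, $x\oplus y$ is coordinatewise addition mod 2, and $\mathbf S$ is the characteristic vector of $S\subseteq J$. For $z\in\{0,1\}^J$, $\mathrm{Match}'(z)$ is the set of partitions of $\{i:z_i=1\}$ into blocks of size 1 or 2. $F:\{0,1\}^J\to\mathbb{Q}_{\ge0}$ is windable if there exist $B(x,y,M)\ge0$ for all $x,y\in\{0,1\}^J$ and $M\in\mathrm{Match}'(x\oplus y)$ with (1) $F(x)F(y)=\sum_{M\in\mathrm{Match}'(x\oplus y)}B(x,y,M)$ for all $x,y$, and (2) $B(x,y,M)=B(x\oplus\mathbf S,y\oplus\mathbf S,M)$ for all $x,y$ and all $S\in M\in\mathrm{Match}'(x\oplus y)$. A matchings circuit $G$ consists of: a finite set $J$ of incidences; a finite vertex set $V$ with sets $J_v$ partitioning $J$; a set $A\subseteq J$ of external edges; a partition $E$ of $J\setminus A$ into pairs (internal edges); a rational edge-weight $w(e)\ge0$ for each $e\in E$; and a rational fugacity $\lambda(v)\ge0$ for each $v$. For $F\subseteq A\cup E$, $\deg_F(v)$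 is the number of incidences in $J_v$ belonging to edges of $F$; $\mathrm{wt}_G(F)=0$ if some $\deg_F(v)\ge2$, else $\prod_{v:\deg_F(v)=0}\lambda(v)\prod_{e\in F\cap E}w(e)$. The signature $[\![G]\!]:\{0,1\}^A\to\mathbb{Q}_{\ge0}$ is $[\![G]\!](x)=\sum\mathrm{wt}_G(F)$ over $F\subseteq A\cup E$ with $F\cap A=\{a:x_a=1\}$. $F$ has a matchings circuit if $F=[\![G]\!]$ for some $G$ (with $A$ identified with $\{1,2,3\}$ via a bijection). *)

(* Defs.v *)
From HB Require Import structures.
From mathcomp Require Import all_boot all_order all_algebra.
Set Implicit Arguments. Unset Strict Implicit. Unset Printing Implicit Defensive.
Import Order.TTheory GRing.Theory Num.Theory.
Local Open Scope ring_scope.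

Definition bvec (J : finType) := {ffun J -> bool}.

Definition bxor (J : finType) (x y : bvec J) : bvec J := [ffun j => x j (+) y j].

Definition charv (J : finType) (S : {set J}) : bvec J := [ffun j => j \in S].

Definition is_match (J : finType) (z : bvec J) (M : {set {set J}}) : bool :=
  partition M [set j | z j] &&
  [forall S in M, (#|S| == 1%N) || (#|S| == 2%N)].

Definition windable (J : finType) (F : bvec J -> rat) : Prop :=
  exists B : bvec J -> bvec J -> {set {set J}} -> rat,
    [/\ (forall x y M, is_match (bxor x y) M -> 0 <= B x y M),
        (forall x y, F x * F y =
            \sum_(M : {set {set J}} | is_match (bxor x y) M) B x y M) &
        (forall x y M S, is_match (bxor x y) M -> S \in M ->
            B x y M = B (bxor x (charv S)) (bxor y (charv S)) M)].

Definition bv3 (a b c : bool) : bvec 'I_3 := [ffun i : 'I_3 => nth false [:: a; b; c] i].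

Definition cond2 (F : bvec 'I_3 -> rat) : Prop :=
  forall x1 x2 x3 : bool,
    F (bv3 x1 x2 x3) * F (bv3 (~~ x1) (~~ x2) (~~ x3)) <=
      F (bv3 x1 x2 (~~ x3)) * F (bv3 (~~ x1) (~~ x2) x3)
    + F (bv3 x1 (~~ x2) x3) * F (bv3 (~~ x1) x2 (~~ x3))
    + F (bv3 x1 (~~ x2) (~~ x3)) * F (bv3 (~~ x1) x2 x3).

(* Matchings circuits.
   - J : incidences, V : vertices, vtx j = the vertex v with j \in J_v
     (vtx surjective, so every J_v is nonempty);
   - ext : 'I_3 -> J injective: the external edges A = image of ext,
     identified with {1,2,3} via ext;
   - E : partition of J \ A into pairs (internal edges);
   - w : edge weights, lam : fugacities.
   A subset F of A ∪ E with F ∩ A = {a : x_a = 1} is determined by x and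
   Fi = F ∩ E. *)

Definition covered (J : finType) (ext : 'I_3 -> J) (x : bvec 'I_3)
    (Fi : {set {set J}}) (j : J) : bool :=
  [exists i : 'I_3, x i && (ext i == j)] || [exists e in Fi, j \in e].

Definition degF (J V : finType) (vtx : J -> V) (ext : 'I_3 -> J) (x : bvec 'I_3)
    (Fi : {set {set J}}) (v : V) : nat :=
  #|[set j | (vtx j == v) && covered ext x Fi j]|.

Definition wtG (J V : finType) (vtx : J -> V) (ext : 'I_3 -> J)
    (w : {set J} -> rat) (lam : V -> rat) (x : bvec 'I_3)
    (Fi : {set {set J}}) : rat :=
  if [exists v : V, 2 <= degF vtx ext x Fi v]%N then 0
  else (\prod_(v : V | degF vtx ext x Fi v == 0%N) lam v) *
       (\prod_(e in Fi) w e).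

Definition signature (J V : finType) (vtx : J -> V) (ext : 'I_3 -> J)
    (E : {set {set J}}) (w : {set J} -> rat) (lam : V -> rat)
    (x : bvec 'I_3) : rat :=
  \sum_(Fi : {set {set J}} | Fi \subset E) wtG vtx ext w lam x Fi.

Definition is_matchings_circuit (J V : finType) (vtx : J -> V) (ext : 'I_3 -> J)
    (E : {set {set J}}) (w : {set J} -> rat) (lam : V -> rat) : Prop :=
  (forall v : V, exists j : J, vtx j = v) /\
  injective ext /\
  partition E (~: [set ext i | i : 'I_3]) /\
  (forall e, e \in E -> #|e| = 2%N) /\
  (forall e, e \in E -> 0 <= w e) /\
  (forall v, 0 <= lam v).

Definition has_matchings_circuit (F : bvec 'I_3 -> rat) : Prop :=
  exists (J V : finType) (vtx : J -> V) (ext : 'I_3 -> J)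
         (E : {set {set J}}) (w : {set J} -> rat) (lam : V -> rat),
    is_matchings_circuit vtx ext E w lam /\
    forall x, F x = signature vtx ext E w lam x.

(* Main.v *)
Require Import Defs.
From HB Require Import structures.
From mathcomp Require Import all_boot all_order all_algebra.
From mathcomp Require Import ring lra zify.
Import Order.TTheory GRing.Theory Num.Theory.
Local Open Scope ring_scope.
Set Implicit Arguments. Unset Strict Implicit. Unset Printing Implicit Defensive.

(* Each condition is read through the four products F(x)F(1-x), one for each
   antipodal pair {x, 1-x}.

   Windability only constrains x, y with y = 1-x.  There, a matching with blocks
   {i}, {j,k} contributes equally to two of the four pairs, so windability asks
   for nonnegative edge weights on K4 whose weighted degrees are the four
   products, and this is possible iff no product exceeds the sum of the others.

   For circuits, let Z(s) be the weighted count of matchings once the vertices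
   in s are used up.  Expanding at a vertex a gives
     Z(s) = lam(a) Z(a::s) + sum_(edges au) w(au) Z(u::a::s),
   and this turns the inequality for Z(s)Z(s+abd) at s into the one for
   Z(s+u)Z(s+bd) at a::s, and conversely; both follow by induction on the number
   of unused vertices.

   Conversely, flip and permute inputs so that F(111) > 0, F(000)F(111) is the
   largest product and F(110)F(001) the smallest.  If the largest product equals
   the sum of the others, a weighted K4 with three external vertices realizes F;
   the general case is reduced to this one by a single row operation, which one
   extra vertex implements. *)

(** * The monomer-dimer partition function *)

(** The value 0 from degree 2 on absorbs the case split of [wtG], which leaves a plain product over
    the vertices. *)
Definition fug (l : rat) (d : nat) : rat :=
  match d with 0%N => l | 1%N => 1 | _ => 0 end.

Definition vweight (V : finType) (lam : V -> rat) (s : seq V) : rat :=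
  \prod_v fug (lam v) (count_mem v s).

(* Monomer-dimer partition function with edge list [es], where [s] lists the
   vertices already used, with multiplicity; a vertex used twice has weight 0. *)
Fixpoint Z (V : finType) (lam : V -> rat) (es : seq (V * V * rat)) (s : seq V)
    : rat :=
  if es is (u, v, w) :: es' then Z lam es' s + w * Z lam es' (u :: v :: s)
  else vweight lam s.

Section Z_theory.
Variables (V : finType) (lam : V -> rat).
Implicit Types (es : seq (V * V * rat)) (s : seq V) (a b d u v : V).

Lemma perm_Z es s s' : perm_eq s s' -> Z lam es s = Z lam es s'.
Proof.
elim: es s s' => [|[[u v] w] es IH] s s' ss' /=.
  by apply: eq_bigr => v _; rewrite (permP ss').
by rewrite (IH s s') // (IH (u :: v :: s) (u :: v :: s')) // !perm_cons.
Qed.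

Lemma Z_dup es s a : (1 < count_mem a s)%N -> Z lam es s = 0.
Proof.
elim: es s => [|[[u v] w] es IH] s us /=.
  rewrite /vweight (bigD1 a) //=.
  by case: (count_mem a s) us => [|[|k]] //= _; rewrite mul0r.
by rewrite !IH ?mulr0 ?addr0 //= !addnA ltn_addl.
Qed.

Lemma Z_ge0 es s : (forall v, 0 <= lam v) -> all (fun e => 0 <= e.2) es ->
  0 <= Z lam es s.
Proof.
move=> l0; elim: es s => [|[[u v] w] es IH] s /=.
  by move=> _; apply: prodr_ge0 => v _; case: count => [|[|k]] //=.
by case/andP=> w0 ws; rewrite addr_ge0 ?mulr_ge0 ?IH.
Qed.

Lemma Z_swap es a b s : Z lam es [:: a, b & s] = Z lam es [:: b, a & s].
Proof. by apply: perm_Z; apply/permP => p /=; lia. Qed.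

Lemma Z_rot es a b d s : Z lam es [:: a, b, d & s] = Z lam es [:: b, d, a & s].
Proof. by apply: perm_Z; apply/permP => p /=; lia. Qed.

Lemma Z_swap23 es a b d s :
  Z lam es [:: a, b, d & s] = Z lam es [:: a, d, b & s].
Proof. by apply: perm_Z; apply/permP => p /=; lia. Qed.

Lemma Z_rot234 es a b d d' s :
  Z lam es [:: a, b, d, d' & s] = Z lam es [:: a, d, d', b & s].
Proof. by apply: perm_Z; apply/permP => p /=; lia. Qed.

(* The choice at [a]: either [a] is unmatched, or it is matched by exactly one
   of the edges [e]. *)
Lemma Z_vertex es s a : a \notin s ->
  Z lam es s = lam a * Z lam es (a :: s) +
    \sum_(e <- es) e.2 * ((e.1.1 == a)%:R * Z lam es (e.1.2 :: a :: s) +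
                          (e.1.2 == a)%:R * Z lam es (e.1.1 :: a :: s)).
Proof.
elim: es s => [|[[u v] w] es IH] s sa /=.
  rewrite big_nil addr0 /vweight (bigD1 a) //= [in RHS](bigD1 a) //=.
  rewrite eqxx (count_memPn sa) /= mul1r; congr (_ * _).
  by apply: eq_bigr => v; rewrite eq_sym => /negPf ->.
have perm3 x y z t : Z lam es [:: x, y, z & t] = Z lam es [:: z, x, y & t].
  by rewrite (Z_rot es z x y).
have perm4 x y z z' t :
    Z lam es [:: x, y, z, z' & t] = Z lam es [:: z, z', x, y & t].
  by apply: perm_Z; apply/permP => p /=; lia.
have dup x y t (H : (1 < count_mem a [:: u, v, x, y & t])%N) := Z_dup es H.
rewrite big_cons /= (IH s sa).
under [in RHS]eq_bigr => e _ do
  rewrite !(mulrDr (_ == a)%:R) addrACA mulrDr.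
rewrite big_split /=.
(* If the new edge touches [a], using it along with another choice at [a] gives 0, and its own
   summand accounts for using it alone. Otherwise the induction hypothesis applies at [s] and at
   [u :: v :: s]. *)
case: (boolP (a \in [:: u; v])) => [auv|].
  rewrite perm3 (@Z_dup es (a :: u :: v :: s) a) ?mulr0 ?addr0; last first.
    move: auv; rewrite !inE !(eq_sym a) /= eqxx.
    by case: (u == a); case: (v == a) => //=; lia.
  rewrite [X in _ + (_ + (_ + X))]big1_seq ?addr0; last first.
    move=> [[x y] z] _ /=.
    have dup' x' : Z lam es [:: u, v, x', a & s] = 0.
      apply: dup; move: auv; rewrite !inE !(eq_sym a) /= eqxx.
      by case: (u == a); case: (v == a) => //=; lia.
    by rewrite !dup'; ring.
  move: auv; rewrite !inE => /orP[] /eqP auv; rewrite -auv eqxx.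
    case: (eqVneq v a) => [->|va].
      by rewrite !(@Z_dup es [:: a, a & _] a) /= ?eqxx //; ring.
    rewrite mul1r mul0r (@Z_dup es [:: a, v, v, a & s] a) ?mulr0 ?addr0;
      last by rewrite /= !eqxx; lia.
    by rewrite Z_swap; ring.
  case: (eqVneq u a) => [->|ua].
    by rewrite !(@Z_dup es [:: a, a & _] a) /= ?eqxx //; ring.
  rewrite mul1r mul0r (@Z_dup es [:: u, a, u, a & s] a) ?mulr0 ?addr0;
      last by rewrite /= !eqxx; lia.
  by ring.
rewrite !inE negb_or => /andP[au av].
rewrite (IH (u :: v :: s)); last by rewrite !inE !negb_or au av.
rewrite !(eq_sym _ a) (negPf au) (negPf av) !mul0r addr0 mulr0 add0r -perm3.
have -> : \sum_(e <- es) e.2 *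
    ((e.1.1 == a)%:R * (w * Z lam es [:: u, v, e.1.2, a & s]) +
     (e.1.2 == a)%:R * (w * Z lam es [:: u, v, e.1.1, a & s])) =
  w * \sum_(e <- es) e.2 *
    ((e.1.1 == a)%:R * Z lam es [:: e.1.2, a, u, v & s] +
     (e.1.2 == a)%:R * Z lam es [:: e.1.1, a, u, v & s]).
  by rewrite mulr_sumr; apply: eq_bigr => e _; rewrite !(perm4 u v); ring.
by ring.
Qed.

(** Permuting [a], [b], [d] yields the remaining two antipodal inequalities. These two are paired
    because the induction derives each from the other. *)
Definition winding_ineqs es s a b d : Prop :=
  Z lam es s * Z lam es [:: a, b, d & s] <=
    Z lam es (a :: s) * Z lam es [:: b, d & s] +
    Z lam es (b :: s) * Z lam es [:: a, d & s] +
    Z lam es (d :: s) * Z lam es [:: a, b & s] /\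
  Z lam es (a :: s) * Z lam es [:: b, d & s] <=
    Z lam es s * Z lam es [:: a, b, d & s] +
    Z lam es (b :: s) * Z lam es [:: a, d & s] +
    Z lam es (d :: s) * Z lam es [:: a, b & s].

Hypothesis lam_ge0 : forall v, 0 <= lam v.

(** The induction puts an arbitrary neighbour in the place of [a], so repeated vertices must be
    covered. The product with [[:: a, b, d & s]] is then 0, and the left side of the second
    inequality is 0 or one of the terms on its right. *)
Lemma winding_ineqs_repeated es s a b d : all (fun e => 0 <= e.2) es ->
  a \in [:: b, d & s] -> winding_ineqs es s a b d.
Proof.
move=> ws H; have Zge0 t : 0 <= Z lam es t by apply: Z_ge0.
have ca t : a \in t -> (1 < count_mem a (a :: t))%N.
  by rewrite -has_pred1 has_count /= eqxx.
rewrite /winding_ineqs (@Z_dup es [:: a, b, d & s] a) ?ca //.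
rewrite mulr0 add0r; split; first by rewrite !addr_ge0 ?mulr_ge0.
move: H; rewrite !inE => /or3P[/eqP<-|/eqP<-|sa].
- by rewrite lerDl mulr_ge0.
- by rewrite (Z_swap _ b) lerDr mulr_ge0.
by rewrite (@Z_dup es (a :: s) a) ?ca // mul0r addr_ge0 ?mulr_ge0.
Qed.

(* Expanding at [a] turns each of the two inequalities at [s] into a
   nonnegative combination of the other one at [a :: s]. *)
Lemma Z_winding es s a b d : all (fun e => 0 <= e.2) es ->
  winding_ineqs es s a b d.
Proof.
move=> ws; have Zge0 t : 0 <= Z lam es t by apply: Z_ge0.
have [n] := ubnP (#|V| - #|[set:: s]|); elim: n => // n IH in s a b d *.
rewrite ltnS => sn.
case: (boolP (a \in [:: b, d & s])) => [|sabd].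
  exact: winding_ineqs_repeated.
have := sabd; rewrite !inE !negb_or => /and3P[ab ad sa].
have sab : a \notin b :: s by rewrite inE negb_or ab.
have sad : a \notin d :: s by rewrite inE negb_or ad.
have step u : winding_ineqs es (a :: s) u b d.
  apply: IH; apply: leq_trans sn.
  rewrite set_cons cardsU1 inE sa ltn_sub2l ?ltnS //.
  rewrite -cardsT; apply: proper_card; rewrite properE subsetT /=.
  by apply: contra sa => /subsetP/(_ a); rewrite !inE; apply.
rewrite /winding_ineqs in step *.
rewrite (Z_vertex es sa) (Z_vertex es sab) (Z_vertex es sad) (Z_vertex es sabd).
rewrite !(Z_rot es a b d) !(Z_swap es a b) !(Z_swap es a d).
rewrite !mulrDl !mulrDr !mulr_suml !mulr_sumr.
set A := Z lam es (a :: s) in step *.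
set AB := Z lam es [:: b, a & s] in step *.
set AD := Z lam es [:: d, a & s] in step *.
set ABD := Z lam es [:: b, d, a & s] in step *.
have mge0 e : e \in es -> 0 <= e.2 by move/(allP ws).
(* The fugacity terms contribute [l1] to both sides and [l2] twice on the right, so only the edge
   sums need comparing. *)
have l1 : 0 <= lam a * A * ABD by rewrite !mulr_ge0 ?Zge0 ?lam_ge0.
have l2 : 0 <= lam a * AB * AD by rewrite !mulr_ge0 ?Zge0 ?lam_ge0.
set S1 := \sum_(e <- es) _; set S2 := \sum_(e <- es) _.
set S3 := \sum_(e <- es) _; set S4 := \sum_(e <- es) _.
suff [h1 h2] : S1 <= S2 + S3 + S4 /\ S2 <= S1 + S3 + S4.
  by split; clear -h1 h2 l1 l2; lra.
have body (X Y Z1 Z2 : V * V * rat -> rat) :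
    (forall e, e \in es -> X e <= Y e + Z1 e + Z2 e) ->
  \sum_(e <- es) X e <=
    \sum_(e <- es) Y e + \sum_(e <- es) Z1 e + \sum_(e <- es) Z2 e.
  move=> h; rewrite -!big_split /= big_seq [leRHS]big_seq; exact: ler_sum.
split; apply: body => [[[u v] w]] /= /mge0 /= w0;
  rewrite !(Z_rot234 _ _ a) !(Z_swap23 _ _ a).
  have [_ /(ler_wpM2l w0) hu] := step u; have [_ /(ler_wpM2l w0) hv] := step v.
  by case: (u == a); case: (v == a); rewrite ?mul1r ?mul0r; lra.
have [/(ler_wpM2l w0) hu _] := step u; have [/(ler_wpM2l w0) hv _] := step v.
by case: (u == a); case: (v == a); rewrite ?mul1r ?mul0r; lra.
Qed.

End Z_theory.

(** * Signatures as partition functions *)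

Lemma sum_subsetU1 (T : finType) (f : {set T} -> rat) k (S : {set T}) :
  k \notin S ->
  \sum_(A : {set T} | A \subset k |: S) f A =
  \sum_(A : {set T} | A \subset S) f A +
  \sum_(A : {set T} | A \subset S) f (k |: A).
Proof.
move=> kS; rewrite (bigID (fun A : {set T} => k \notin A)) /=; congr (_ + _).
  by apply: eq_bigl => A; rewrite -subsetD1 setU1K.
rewrite (reindex_onto (fun A : {set T} => k |: A)
                      (fun A : {set T} => A :\ k)) /=; last first.
  by move=> A /andP[_]; rewrite negbK => kA; rewrite setD1K.
apply: eq_bigl => A; rewrite in_setU1 eqxx /= andbT.
apply/andP/idP => [[sub /eqP <-]|sub].
  by rewrite -(setU1K kS) setSD.
by rewrite setUS // setU1K // (contra _ kS) // => /(subsetP sub).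
Qed.

(** Splitting on the first edge is the recursion of [Z]: a chosen edge moves its two endpoints to
    the used vertices. *)
Lemma sum_subsets_Z (T V K : finType) (lam : V -> rat) (w : T -> rat)
    (d : T -> V -> nat) (edge : K -> T) (src tgt : K -> V) ks s :
  (forall k v, k \in ks -> d (edge k) v = (src k == v) + (tgt k == v))%N ->
  uniq (map edge ks) ->
  \sum_(A : {set T} | A \subset [set:: map edge ks])
    (\prod_v fug (lam v) (count_mem v s + \sum_(e in A) d e v)%N) *
    \prod_(e in A) w e =
  Z lam [seq (src k, tgt k, w (edge k)) | k <- ks] s.
Proof.
elim: ks s => [|k ks IH] s dk /=.
  move=> _; rewrite set_nil; under eq_bigl do rewrite subset0.
  rewrite big_pred1_eq big_set0 mulr1; apply: eq_bigr => v _.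
  by rewrite big_set0 addn0.
case/andP=> kks uks; rewrite set_cons sum_subsetU1 ?inE //.
have dk' k' v : k' \in ks -> d (edge k') v = ((src k' == v) + (tgt k' == v))%N.
  by move=> k'ks; rewrite dk // inE k'ks orbT.
rewrite -!IH // mulr_sumr; congr (_ + _); apply: eq_bigr => A sA.
have kA : edge k \notin A by apply: contra kks => /(subsetP sA); rewrite inE.
rewrite big_setU1 //= mulrCA; congr (_ * (_ * _)); apply: eq_bigr => v _.
by rewrite big_setU1 //= dk ?mem_head //; congr fug; lia.
Qed.

Lemma exists_sum1 (I : finType) (P : pred I) :
  (forall i j, P i -> P j -> i = j) -> [exists i, P i] = (\sum_i P i)%N :> nat.
Proof.
move=> uP; case: existsP => [[i Pi]|nP].
  rewrite (bigD1 i) //= Pi big1 ?addn0 // => j ji.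
  by apply/eqP; rewrite eqb0; apply: contra ji => Pj; rewrite (uP j i).
rewrite big1 // => i _; apply/eqP; rewrite eqb0; apply/negP => Pi.
by apply: nP; exists i.
Qed.

Section SignatureZ.
Variables (J V : finType) (vtx : J -> V) (ext : 'I_3 -> J) (E : {set {set J}}).
Variables (w : {set J} -> rat) (lam : V -> rat).
Hypothesis ext_inj : injective ext.
Hypothesis partE : partition E (~: [set ext i | i : 'I_3]).

(** The edges, external and internal, are pairwise disjoint, so at most one of them contains [j]. *)
Lemma covered_sum x (Fi : {set {set J}}) j : Fi \subset E ->
  covered ext x Fi j =
  (\sum_i (x i && (ext i == j)) + \sum_e ((e \in Fi) && (j \in e)))%N :> nat.
Proof.
move=> sFi; have /and3P[/eqP covE tE _] := partE.
rewrite -!exists_sum1 /covered.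
- case: existsP => [[i /andP[xi /eqP ij]]|//=].
  case: existsP => [[e /andP[eFi je]]|//=].
  have : j \in cover E by apply/bigcupP; exists e => //; apply: (subsetP sFi).
  by rewrite covE inE -ij imset_f.
- move=> e e' /andP[/(subsetP sFi) eE je] /andP[/(subsetP sFi) e'E je'].
  by rewrite -(def_pblock tE eE je) -(def_pblock tE e'E je').
by move=> i i' /andP[_ /eqP<-] /andP[_ /eqP/ext_inj].
Qed.

(** A present external edge carries no weight and only uses up its vertex, so it enters [Z] as a
    used vertex. *)
Definition removed (v : 'I_3 -> V) (x : bvec 'I_3) : seq V :=
  nseq (x 0) (v 0) ++ nseq (x 1) (v 1) ++ nseq (x 2%R) (v 2%R).

Lemma degF_sum x (Fi : {set {set J}}) v : Fi \subset E ->
  degF vtx ext x Fi v =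
  (count_mem v (removed (vtx \o ext) x) +
   \sum_(e in Fi) #|[set j in e | vtx j == v]|)%N.
Proof.
move=> sFi; rewrite /degF -sum1dep_card big_mkcondr /=.
transitivity (\sum_(j | vtx j == v) covered ext x Fi j)%N.
  by apply: eq_bigr => j _; case: covered.
under eq_bigr => j _ do rewrite (covered_sum x j sFi).
rewrite big_split /= exchange_big /= [X in (_ + X)%N]exchange_big /=.
congr (_ + _)%N.
  transitivity (\sum_i (x i && (vtx (ext i) == v)))%N.
    apply: eq_bigr => i _; rewrite big_mkcond (bigD1 (ext i)) //= eqxx andbT.
    rewrite big1 ?addn0; first by case: (x i); case: (_ == v).
    by move=> j; rewrite eq_sym => /negPf->; rewrite andbF if_same.
  rewrite !big_ord_recl big_ord0 /removed !count_cat !count_nseq /= addn0.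
  have -> : lift ord0 ord0 = 1 :> 'I_3 by apply: val_inj.
  have -> : lift ord0 (lift ord0 ord0) = 2%R :> 'I_3 by apply: val_inj.
  by rewrite -!mulnb !(mulnC (x _)).
rewrite [RHS]big_mkcond; apply: eq_bigr => e _; case: (e \in Fi) => /=.
  by rewrite -sum1dep_card big_mkcond [RHS]big_mkcond; apply: eq_bigr => j _;
     case: (_ == v); case: (j \in e).
by rewrite big1.
Qed.

Lemma wtG_prod x (Fi : {set {set J}}) : wtG vtx ext w lam x Fi =
  (\prod_v fug (lam v) (degF vtx ext x Fi v)) * \prod_(e in Fi) w e.
Proof.
rewrite /wtG; case: existsP => [[v]|nd].
  by case dE: degF => [|[|k]] // _; rewrite (bigD1 v) //= dE /= !mul0r.
congr (_ * _); rewrite big_mkcond; apply: eq_bigr => v _.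
by case dE: degF => [|[|k]] //; case: nd; exists v; rewrite dE.
Qed.

Lemma signature_Z (K : finType) (edge : K -> {set J}) (src tgt : K -> V) ks x :
  E = [set:: map edge ks] -> uniq (map edge ks) ->
  (forall k v, k \in ks ->
     #|[set j in edge k | vtx j == v]| = (src k == v) + (tgt k == v))%N ->
  signature vtx ext E w lam x =
  Z lam [seq (src k, tgt k, w (edge k)) | k <- ks] (removed (vtx \o ext) x).
Proof.
move=> EE ue de; pose d (e : {set J}) v := #|[set j in e | vtx j == v]|.
rewrite -(@sum_subsets_Z _ _ _ lam w d _ _ _ _ _ de) // -EE.
apply: eq_bigr => Fi sFi; rewrite wtG_prod; congr (_ * _).
by apply: eq_bigr => v _; rewrite degF_sum.
Qed.

End SignatureZ.

Lemma card_pair_fiber (J V : finType) (vtx : J -> V) j j' v : j != j' ->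
  #|[set i in [set j; j'] | vtx i == v]| = ((vtx j == v) + (vtx j' == v))%N.
Proof.
move=> jj'; rewrite -sum1dep_card big_mkcondr /= big_setU1 ?inE //= big_set1.
by case: (_ == v); case: (_ == v).
Qed.

Lemma signature_exists_Z (J V : finType) (vtx : J -> V) ext E w lam :
  is_matchings_circuit vtx ext E w lam ->
  exists2 es, all (fun e => 0 <= e.2) es &
    forall x, signature vtx ext E w lam x = Z lam es (removed (vtx \o ext) x).
Proof.
case=> _ [ext_inj [partE [E2 [w0 _]]]].
pose j1 (e : {set J}) := nth (ext 0) (enum e) 0.
pose j2 (e : {set J}) := nth (ext 0) (enum e) 1.
have eE e : e \in E -> e = [set j1 e; j2 e] /\ j1 e != j2 e.
  move/E2 => ce; have := enum_uniq e.
  have se : size (enum e) = 2%N by rewrite -cardE.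
  rewrite /j1 /j2; case ee: (enum e) se => [|a [|b [|]]] //= _.
  rewrite inE andbT => ab; split=> //.
  by apply/setP => i; rewrite -mem_enum ee !inE.
exists [seq (vtx (j1 e), vtx (j2 e), w e) | e <- enum E].
  by apply/allP => t /mapP[e]; rewrite mem_enum => eEE -> /=; apply: w0.
move=> x; rewrite (@signature_Z _ _ _ _ _ _ _ ext_inj partE _ id
  (vtx \o j1) (vtx \o j2) (enum E)) //.
- by apply/setP => e; rewrite map_id inE mem_enum.
- by rewrite map_id enum_uniq.
move=> e v; rewrite mem_enum => /eE [ee ej].
by rewrite /= -(card_pair_fiber vtx v ej) -ee.
Qed.

Lemma removed_bv3 (V : finType) (v : 'I_3 -> V) a b c :
  removed v (bv3 a b c) = nseq a (v 0) ++ nseq b (v 1) ++ nseq c (v 2%R).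
Proof. by rewrite /removed !ffunE. Qed.

Lemma circuit_cond2 (F : bvec 'I_3 -> rat) :
  has_matchings_circuit F -> cond2 F.
Proof.
case=> J [V [vtx [ext [E [w [lam [circ FE]]]]]]] x1 x2 x3.
have [es es0 sE] := signature_exists_Z circ.
have lam0 v : 0 <= lam v by case: circ => _ [_ [_ [_ [_]]]].
rewrite !FE !sE !removed_bv3.
set a := (vtx \o ext) 0; set b := (vtx \o ext) 1; set d := (vtx \o ext) 2%R.
have [h1 h2] := Z_winding lam0 [::] a b d es0.
(* The two inequalities still missing are the second one with [d] and with [b] in the place of
   [a]. *)
have := proj2 (Z_winding lam0 [::] d a b es0).
have := proj2 (Z_winding lam0 [::] b a d es0).
rewrite (Z_rot lam es d a b) (Z_swap lam es b a [:: d]).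
rewrite (Z_swap lam es b a [::]) (Z_swap lam es d a [::]).
rewrite (Z_swap lam es d b [::]).
move=> h3 h4; clear -h1 h2 h3 h4.
by case: x1; case: x2; case: x3 => /=; lra.
Qed.

(** * Realizing a function by a circuit *)

(** With edges in a list, attaching a gadget is a list operation. The [has] clause makes every
    vertex meet an internal edge, so that [vtx] is surjective in the circuit built from this
    data. *)
Definition realizable (f : bool -> bool -> bool -> rat) : Prop :=
  exists (V : finType) (lam : V -> rat) (es : seq (V * V * rat)) (v1 v2 v3 : V),
    [/\ forall v, 0 <= lam v, all (fun e => 0 <= e.2) es,
        forall v, has (fun e => (e.1.1 == v) || (e.1.2 == v)) es &
        forall a b c,
          f a b c = Z lam es (nseq a v1 ++ nseq b v2 ++ nseq c v3)].

Lemma eq_realizable f g : (forall a b c, f a b c = g a b c) ->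
  realizable f -> realizable g.
Proof.
move=> fg [V [lam [es [v1 [v2 [v3 [l0 e0 cov fE]]]]]]].
by exists V, lam, es, v1, v2, v3; split=> // a b c; rewrite -fg.
Qed.

Lemma realizable_swap12 f :
  realizable f -> realizable (fun a b c => f b a c).
Proof.
move=> [V [lam [es [v1 [v2 [v3 [l0 e0 cov fE]]]]]]].
exists V, lam, es, v2, v1, v3; split=> // a b c; rewrite fE.
by apply: perm_Z; apply/permP => p; rewrite !count_cat; lia.
Qed.

Lemma realizable_swap23 f :
  realizable f -> realizable (fun a b c => f a c b).
Proof.
move=> [V [lam [es [v1 [v2 [v3 [l0 e0 cov fE]]]]]]].
exists V, lam, es, v1, v3, v2; split=> // a b c; rewrite fE.
by apply: perm_Z; apply/permP => p; rewrite !count_cat; lia.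
Qed.

Lemma realizable_circuit f : realizable f ->
  has_matchings_circuit (fun x => f (x 0) (x 1) (x 2%R)).
Proof.
move=> [V [lam [es [v1 [v2 [v3 [l0 e0 cov fE]]]]]]].
(* Each list position gets its own two incidences, so loops and parallel edges become distinct
   pairs. *)
pose K : finType := 'I_(size es); pose J : finType := ('I_3 + K * bool)%type.
pose e_ (k : K) := nth (v1, v1, 0) es k.
pose ev (i : 'I_3) := nth v1 [:: v1; v2; v3] i.
pose vtx (j : J) : V := match j with
  | inl i => ev i
  | inr (k, true) => (e_ k).1.1
  | inr (k, false) => (e_ k).1.2
  end.
pose ext (i : 'I_3) : J := inl i.
pose edge (k : K) : {set J} := [set inr (k, true); inr (k, false)].
pose w (e : {set J}) : rat :=
  if [pick k : K | e == edge k] is Some k then (e_ k).2 else 0.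
have edge_inj : injective edge.
  move=> k k' /setP/(_ (inr (k, true))).
  by rewrite !inE eqxx => /esym/orP[]/eqP[].
have wE k : w (edge k) = (e_ k).2.
  by rewrite /w; case: pickP => [k' /eqP/edge_inj->|/(_ k)]//; rewrite eqxx.
have ne (k : K) : inr (k, true) != inr (k, false) :> J by apply/eqP => -[].
have ext_inj : injective ext by move=> i i' [].
pose E := [set edge k | k : K].
have partE : partition E (~: [set ext i | i : 'I_3]).
  apply/and3P; split.
  - apply/eqP/setP => -[i|[k b]]; rewrite !inE.
      rewrite imset_f //=; apply/negbTE/bigcupP => -[_ /imsetP[k _ ->]].
      by rewrite !inE.
    apply/bigcupP/idP => [_|_].
      by apply/imsetP => -[].
    by exists (edge k); rewrite ?imset_f // !inE; case: b; rewrite eqxx ?orbT.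
  - apply/trivIsetP => _ _ /imsetP[k _ ->] /imsetP[k' _ ->] kk'.
    rewrite -setI_eq0; apply/eqP/setP => j; rewrite !inE; apply/negbTE.
    apply: contra kk' => /andP[] /orP[]/eqP-> /orP[]/eqP[] // ->; exact: eqxx.
  by apply/imsetP => -[k _ /setP/(_ (inr (k, true)))]; rewrite !inE eqxx.
exists J, V, vtx, ext, E, w, lam; split.
  split=> [v|].
    have /(has_nthP (v1, v1, 0))[k ks /orP[]/eqP kv] := cov v.
      by exists (inr (Ordinal ks, true)).
    by exists (inr (Ordinal ks, false)).
  do 2!split=> //; split=> [e /imsetP[k _ ->]|]; first by rewrite cards2 ne.
  by split=> // e /imsetP[k _ ->]; rewrite wE; apply: (allP e0); rewrite mem_nth.
move=> x; rewrite (@signature_Z _ _ _ _ _ _ _ ext_inj partE _ edge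
  (fun k => (e_ k).1.1) (fun k => (e_ k).1.2) (enum K)).
- rewrite fE; congr Z.
  rewrite -[LHS](mkseq_nth (v1, v1, 0)) /mkseq -val_enum_ord -map_comp.
  by apply: eq_map => k; rewrite wE /=; rewrite -/(e_ k); case: (e_ k) => -[].
- by apply/setP => e; rewrite inE; apply/imsetP/mapP => -[k _ ->];
     exists k; rewrite ?mem_enum.
- by rewrite map_inj_uniq ?enum_uniq.
by move=> k v _; rewrite card_pair_fiber ?ne.
Qed.

(** * Gadgets: pendant vertex, weighted K4, complemented inputs *)

Section Pendant.
Variables (V : finType) (lam : V -> rat).

(** Fugacity 0 forces the new vertex [None] to be matched or used. *)
Definition lam_pendant (v : option V) : rat := oapp lam 0 v.

Definition lift_edge (e : V * V * rat) : option V * option V * rat :=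
  (Some e.1.1, Some e.1.2, e.2).

Lemma Z_pendant es n s :
  Z lam_pendant (map lift_edge es) (nseq n None ++ map Some s) =
  fug 0 n * Z lam es s.
Proof.
elim: es s => [|[[u v] w] es IH] s /=; last first.
  rewrite IH mulrDr mulrCA -(IH (u :: v :: s)); congr (_ + _ * _).
  by apply: perm_Z; apply/permP => p /=; rewrite !count_cat /=; lia.
rewrite /vweight (bigD1 None) //= count_cat count_nseq /= mul1n.
have -> : count_mem None (map Some s) = 0%N by elim: s.
rewrite addn0; congr (_ * _).
rewrite (reindex_omap Some id) => [|[v|]//]; apply: eq_big => [v|v _].
  by rewrite /= eqxx.
by rewrite count_cat count_nseq /= mul0n add0n count_map.
Qed.

End Pendant.

(** A new vertex takes over the second external edge and is joined to [v2] with weight 1 and to [v1]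
    with weight [beta]. If its external edge is present, both new edges are blocked; if not, it must
    be matched to [v2], or to [v1] when [v1] is free. *)
Lemma realizable_pendant f beta : 0 <= beta -> realizable f ->
  realizable (fun a b c => if b then f a false c else
    f a true c + (if a then 0 else beta * f true false c)).
Proof.
move=> beta0 [V [lam [es [v1 [v2 [v3 [l0 e0 cov fE]]]]]]].
exists (option V), (lam_pendant lam),
  [:: (None, Some v2, 1), (None, Some v1, beta) & map (@lift_edge V) es],
  (Some v1), None, (Some v3).
split.
- by case.
- by rewrite /= beta0 /= all_map.
- case=> [v|]; last by [].
  rewrite /= has_map; apply/orP; right; apply/orP; right.
  by case/hasP: (cov v) => e ee ev; apply/hasP; exists e.
move=> a b c /=.
have zp n s t : perm_eq t (nseq n None ++ map Some s) ->
    Z (lam_pendant lam) (map (@lift_edge V) es) t = fug 0 n * Z lam es s.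
  by move=> /perm_Z ->; apply: Z_pendant.
pose r := nseq a v1 ++ nseq c v3.
have cat_perm s' p : count p (nseq a (Some v1) ++ s' ++ nseq c (Some v3)) =
    (count p s' + count p (map Some r))%N.
  by rewrite map_cat !map_nseq !count_cat; lia.
rewrite !fE !mul1r; case: b => /=.
  rewrite (zp 1%N r); last
    by apply/permP => p /=; rewrite (cat_perm [:: None]) /=; lia.
  rewrite (zp 2%N (v1 :: r)); last
    by apply/permP => p /=; rewrite (cat_perm [:: None]) /=; lia.
  rewrite (zp 2%N (v2 :: r)); last
    by apply/permP => p /=; rewrite (cat_perm [:: None]) /=; lia.
  rewrite (zp 3%N [:: v1, v2 & r]); last
    by apply/permP => p /=; rewrite (cat_perm [:: None]) /=; lia.
  by rewrite /r /=; ring.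
rewrite (zp 0%N r); last
    by apply/permP => p /=; rewrite (cat_perm [::]) /=; lia.
rewrite (zp 1%N (v1 :: r)); last
    by apply/permP => p /=; rewrite (cat_perm [::]) /=; lia.
rewrite (zp 1%N (v2 :: r)); last
    by apply/permP => p /=; rewrite (cat_perm [::]) /=; lia.
rewrite (zp 2%N [:: v1, v2 & r]); last
    by apply/permP => p /=; rewrite (cat_perm [::]) /=; lia.
have -> : Z lam es (nseq a v1 ++ v2 :: nseq c v3) = Z lam es (v2 :: r).
  by apply: perm_Z; apply/permP => p; rewrite /r /= !count_cat /=; lia.
rewrite /r; case: (a) => /=; last by ring.
by rewrite (@Z_dup _ _ _ [:: v1, v1 & _] v1) /= ?eqxx //; ring.
Qed.

(** Only the fourth vertex has nonzero fugacity, so each value counts the matchings that cover all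
    external vertices still free. *)
Lemma realizable_K4 l w12 w13 w14 w23 w24 w34 :
  0 <= l -> 0 <= w12 -> 0 <= w13 -> 0 <= w14 -> 0 <= w23 -> 0 <= w24 ->
  0 <= w34 ->
  realizable (fun a b c => match a, b, c with
    | true, true, true => l
    | true, true, false => w34
    | true, false, true => w24
    | false, true, true => w14
    | true, false, false => w23 * l
    | false, true, false => w13 * l
    | false, false, true => w12 * l
    | false, false, false => w12 * w34 + w13 * w24 + w14 * w23
    end).
Proof.
move=> l0 h12 h13 h14 h23 h24 h34.
pose v1 := @Ordinal 4 0 isT; pose v2 := @Ordinal 4 1 isT.
pose v3 := @Ordinal 4 2 isT; pose v4 := @Ordinal 4 3 isT.
pose lam (v : 'I_4) := if v == v4 then l else 0.
exists 'I_4, lam, [:: (v1, v2, w12); (v1, v3, w13); (v1, v4, w14);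
  (v2, v3, w23); (v2, v4, w24); (v3, v4, w34)], v1, v2, v3.
have vE s : vweight lam s = fug 0 (count_mem v1 s) * fug 0 (count_mem v2 s) *
   fug 0 (count_mem v3 s) * fug l (count_mem v4 s).
  rewrite /vweight !big_ord_recl big_ord0 mulr1 !mulrA.
  by do ![congr (_ * _)]; rewrite /lam /=;
    congr (fug _ (count_mem _ s)); apply: val_inj.
split.
- by move=> v; rewrite /lam; case: ifP.
- by rewrite /= h12 h13 h14 h23 h24 h34.
- by case=> -[|[|[|[|]]]].
by case; case; case; rewrite /= !vE /=; ring.
Qed.

(** With [beta] equal to 0 the pendant vertex just sits in series with the second external edge:
    exactly one of its two edges is present. *)
Lemma realizable_flip2 f :
  realizable f -> realizable (fun a b c => f a (~~ b) c).
Proof.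
move/(realizable_pendant (lexx 0)); apply: eq_realizable => a [] c //=.
by rewrite mul0r if_same addr0.
Qed.

Lemma realizable_flip (i j k : bool) f : realizable f ->
  realizable (fun a b c => f (a (+) i) (b (+) j) (c (+) k)).
Proof.
move=> rf.
have r1 : realizable (fun a b c => f (a (+) i) b c).
  case: i; last by apply: eq_realizable rf => a b c; rewrite addbF.
  have := realizable_swap12 (realizable_flip2 (realizable_swap12 rf)).
  by apply: eq_realizable => a b c; rewrite addbT.
have r2 : realizable (fun a b c => f (a (+) i) (b (+) j) c).
  case: j; last by apply: eq_realizable r1 => a b c; rewrite addbF.
  by apply: eq_realizable (realizable_flip2 r1) => a b c; rewrite addbT.
case: k; last by apply: eq_realizable r2 => a b c; rewrite addbF.
have := realizable_swap23 (realizable_flip2 (realizable_swap23 r2)).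
by apply: eq_realizable => a b c; rewrite addbT.
Qed.

(** * From the antipodal inequalities to a circuit *)

Definition antipodal (f : bool -> bool -> bool -> rat) a b c :=
  f a b c * f (~~ a) (~~ b) (~~ c).

(* The equality case of the antipodal inequality is a complete graph on the
   three external vertices and one further vertex of fugacity [f 1 1 1]. *)
Lemma realizable_tight (f : bool -> bool -> bool -> rat) :
  (forall a b c, 0 <= f a b c) ->
  0 < f true true true ->
  antipodal f true true true = antipodal f true true false +
    antipodal f true false true + antipodal f false true true ->
  realizable f.
Proof.
rewrite /antipodal /= => f0 l0 tight; have lN0 := lt0r_neq0 l0.
(* The weights are read off from the seven values other than the one at 000; [tight] makes that last
   one agree. *)
have := @realizable_K4 (f true true true)
  (f false false true / f true true true) (f false true false / f true true true)
  (f false true true) (f true false false / f true true true)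
  (f true false true) (f true true false).
rewrite !divr_ge0 ?f0 // => /(_ isT isT isT isT isT isT isT).
apply: eq_realizable => -[] [] [] //; rewrite ?divfK //.
by apply: (mulfI lN0); rewrite tight; field.
Qed.

(* Subtracting [beta] times the row [f 1 0 _] from the row [f 0 1 _], which
   one extra vertex undoes, lowers two of the four antipodal products by the same
   amount and keeps the other two; [beta] is chosen to reach the tight case. *)
Lemma realizable_sorted (f : bool -> bool -> bool -> rat) :
  (forall a b c, 0 <= f a b c) ->
  0 < f true true true ->
  let p0 := antipodal f true true true in
  let p1 := antipodal f true true false in
  let p2 := antipodal f true false true in
  let p3 := antipodal f false true true in
  p1 <= p2 -> p1 <= p3 -> p2 <= p0 -> p3 <= p0 -> p0 <= p1 + p2 + p3 ->
  realizable f.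
Proof.
move=> f0 l0 p0 p1 p2 p3 p12 p13 p20 p30 p0le.
(* The row operation with factor [beta] lowers both [p2] and [p3] by [beta * q]; solving for
   equality gives the [beta] below. *)
pose q := f true false false * f true false true.
(* If [q] is 0, then [p2] or [p3] is 0, hence so is the smallest product [p1], and the remaining one
   is at most [p0]: the case is already tight. *)
have [q0|qN0] := eqVneq q 0.
  apply: realizable_tight => //; apply: le_anti; rewrite p0le /=.
  have : p2 = 0 \/ p3 = 0.
    by move/eqP: q0; rewrite mulf_eq0 /p2 /p3 /antipodal => /orP[]/eqP->;
       [right; rewrite mulr0|left; rewrite mul0r].
  have : 0 <= p1 by rewrite mulr_ge0.
  rewrite -/p0 -/p1 -/p2 -/p3; clear -p12 p13 p20 p30 => h []; lra.
have qgt0 : 0 < q by rewrite lt_neqAle eq_sym qN0 mulr_ge0.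
pose beta := (p1 + p2 + p3 - p0) / (2 * q).
have betaE : beta * (2 * q) = p1 + p2 + p3 - p0.
  by rewrite divfK // mulf_neq0 ?pnatr_eq0.
have beta0 : 0 <= beta by rewrite divr_ge0 ?mulr_ge0 ?subr_ge0 // ltW.
pose g a b c := f a b c -
  (if ~~ a && b then beta * f true false c else 0).
have f1F : 0 < f true false false.
  by rewrite lt_neqAle f0 andbT eq_sym;
     apply: contraNneq qN0; rewrite /q => ->; rewrite mul0r.
have f1T : 0 < f true false true.
  by rewrite lt_neqAle f0 andbT eq_sym;
     apply: contraNneq qN0; rewrite /q => ->; rewrite mulr0.
have g0 a b c : 0 <= g a b c.
  rewrite /g; case: a b => -[] /=; rewrite ?subr0 //.
  (* Multiplied by the positive [f true false (~~ c)], the claim is that [beta * q] is at most [p3]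
     or [p2], which holds because [p1] is the smallest and [p0] the largest product. *)
  rewrite subr_ge0; case: c.
    rewrite -(ler_pM2r f1F); move: betaE p12 p13 p20 p30.
    by rewrite /q /p0 /p1 /p2 /p3 /antipodal /=; clear; lra.
  rewrite -(ler_pM2r f1T); move: betaE p12 p13 p20 p30.
  by rewrite /q /p0 /p1 /p2 /p3 /antipodal /=; clear; lra.
have rg : realizable g.
  apply: realizable_tight; rewrite ?/antipodal /g /= ?subr0 //.
  move: betaE; rewrite /q /p0 /p1 /p2 /p3 /antipodal /=; clear; lra.
(* The pendant vertex adds the row back but complements the second input; the flip undoes that. *)
apply: eq_realizable (realizable_flip2 (realizable_pendant beta0 rg)).
by move=> [] [] c; rewrite /g /=; ring.
Qed.

(** Permuting the inputs fixes 111 and permutes the other three products, so the smallest of them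
    can be moved to 110. *)
Lemma realizable_max (g : bool -> bool -> bool -> rat) :
  (forall a b c, 0 <= g a b c) -> 0 < g true true true ->
  (forall a b c, antipodal g a b c <= antipodal g true true true) ->
  antipodal g true true true <= antipodal g true true false +
    antipodal g true false true + antipodal g false true true ->
  realizable g.
Proof.
move=> g0 gpos gmax gle.
have m1 := gmax true true false; have m2 := gmax true false true.
have m3 := gmax false true true.
have min2 : antipodal g true false true <= antipodal g true true false ->
    antipodal g true false true <= antipodal g false true true -> realizable g.
  move=> p21 p23; apply: (@realizable_swap23 (fun a b c => g a c b)).
  apply: realizable_sorted => //; move: m1 m2 m3 p21 p23 gle;
    by rewrite /antipodal /=; clear; lra.
have min3 : antipodal g false true true <= antipodal g true true false ->
    antipodal g false true true <= antipodal g true false true -> realizable g.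
  move=> p31 p32; apply: (@realizable_swap12 (fun a b c => g b a c)).
  apply: (@realizable_swap23 (fun a b c => g c a b)).
  apply: (@realizable_swap12 (fun a b c => g c b a)).
  apply: realizable_sorted => //; move: m1 m2 m3 p31 p32 gle;
    by rewrite /antipodal /=; clear; lra.
have [p12|/ltW p21] :=
    lerP (antipodal g true true false) (antipodal g true false true).
  have [p13|/ltW p31] :=
    lerP (antipodal g true true false) (antipodal g false true true).
    exact: realizable_sorted.
  by apply: min3 => //; apply: le_trans p12.
have [p23|/ltW p32] :=
    lerP (antipodal g true false true) (antipodal g false true true).
  exact: min2.
by apply: min3 => //; apply: le_trans p21.
Qed.

Lemma realizable_ineq (f : bool -> bool -> bool -> rat) :
  (forall a b c, 0 <= f a b c) ->
  (forall a b c, antipodal f a b c <= antipodal f a b (~~ c) +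
     antipodal f a (~~ b) c + antipodal f a (~~ b) (~~ c)) ->
  realizable f.
Proof.
move=> f0 fle.
have [f00|] := boolP [forall x : bool * bool * bool, f x.1.1 x.1.2 x.2 == 0].
  have fz a b c : f a b c = 0 by apply/eqP: (forallP f00 (a, b, c)).
  have := @realizable_K4 0 0 0 0 0 0 0 (lexx _) (lexx _) (lexx _) (lexx _)
    (lexx _) (lexx _) (lexx _).
  by apply: eq_realizable => -[] [] []; rewrite fz ?mul0r ?addr0.
rewrite negb_forall => /existsP[y fy].
pose p (x : bool * bool * bool) := antipodal f x.1.1 x.1.2 x.2.
have p0 x : 0 <= p x by rewrite mulr_ge0.
have [z zpos zmax] : exists2 z, 0 < f z.1.1 z.1.2 z.2 & forall x, p x <= p z.
  have [z _ zmax] := arg_maxP p (isT : xpredT y).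
  (* If the maximum is 0, all products vanish and any point is a maximizer, in particular [y], where
     [f] is positive. *)
  have [pz|pz] := eqVneq (p z) 0.
    exists y; first by rewrite lt_neqAle eq_sym fy f0.
    by move=> x; apply: le_trans (p0 y); rewrite -pz; apply: zmax.
  exists z => [|x]; last exact: zmax.
  rewrite lt_neqAle f0 andbT eq_sym; apply: contraNneq pz.
  by rewrite /p /antipodal => ->; rewrite mul0r.
(* Complementing inputs moves the maximizer [z] to 111. *)
pose g a b c := f (a (+) ~~ z.1.1) (b (+) ~~ z.1.2) (c (+) ~~ z.2).
suff : realizable g.
  move/(realizable_flip (~~ z.1.1) (~~ z.1.2) (~~ z.2)).
  by apply: eq_realizable => a b c; rewrite /g -!addbA !addbb !addbF.
have g0 a b c : 0 <= g a b c by apply: f0.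
have pg a b c : antipodal g a b c =
    p (a (+) ~~ z.1.1, b (+) ~~ z.1.2, c (+) ~~ z.2).
  by rewrite /antipodal /g /p /antipodal /= !addNb.
have gmax a b c : antipodal g a b c <= antipodal g true true true.
  by rewrite !pg !addTb !negbK; case: z {zpos g g0 pg} zmax => -[].
have gpos : 0 < g true true true by rewrite /g !addTb !negbK.
have gle : antipodal g true true true <= antipodal g true true false +
    antipodal g true false true + antipodal g false true true.
  have := fle z.1.1 z.1.2 z.2.
  by rewrite /antipodal /g /= !negbK; clear; lra.
exact: realizable_max.
Qed.

Lemma bv3E (x : bvec 'I_3) : x = bv3 (x 0) (x 1) (x 2%R).
Proof.
apply/ffunP => -[[|[|[|//]]] i] /=; rewrite ffunE /=;
  congr (x _); exact: val_inj.
Qed.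

Lemma cond2_circuit (F : bvec 'I_3 -> rat) : (forall x, 0 <= F x) ->
  cond2 F -> has_matchings_circuit F.
Proof.
move=> F0 Fle.
have /realizable_circuit : realizable (fun a b c => F (bv3 a b c)).
  apply: realizable_ineq => [a b c|a b c]; first exact: F0.
  by rewrite /antipodal /= !negbK; apply: Fle.
case=> J [V [vtx [ext [E [w [lam [circ FE]]]]]]].
exists J, V, vtx, ext, E, w, lam; split=> // x.
by rewrite -FE -bv3E.
Qed.

(** * Windability *)

Lemma flip_bv3 a b c (S : {set 'I_3}) :
  bxor (bv3 a b c) (charv S) =
  bv3 (a (+) (0 \in S)) (b (+) (1 \in S)) (c (+) (2%R \in S)).
Proof. by rewrite [LHS]bv3E !ffunE. Qed.

(** In any matching of all three indices, the block of 0 is one of three sets. Flipping that block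
    turns the term of the matching into a term of one of the three products on the right. *)
Lemma windable_cond2 (F : bvec 'I_3 -> rat) : windable F -> cond2 F.
Proof.
case=> B [B0 FB Binv] a b c.
pose x := bv3 a b c; pose y := bv3 (~~ a) (~~ b) (~~ c).
have xy : bxor x y = charv setT.
  by apply/ffunP => -[[|[|[|//]]] i]; rewrite !ffunE !inE /= addbN addbb.
pose T S := F (bxor x (charv S)) * F (bxor y (charv S)).
have xyS S : bxor (bxor x (charv S)) (bxor y (charv S)) = charv setT.
  by rewrite -xy; apply/ffunP => i; rewrite !ffunE addbACA addbb addbF.
have TE S : T S = \sum_(M | is_match (charv setT) M)
    B (bxor x (charv S)) (bxor y (charv S)) M.
  by rewrite /T FB xyS.
have Bge0 S M : is_match (charv setT) M ->
    0 <= B (bxor x (charv S)) (bxor y (charv S)) M.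
  by move=> mM; apply: B0; rewrite xyS.
have le : F x * F y <= T [set 0] + T [set 0; 1] + T [set 0; 2%R].
  rewrite FB xy !TE -!big_split /=; apply: ler_sum => M mM.
  have /andP[/and3P[/eqP covM tM _] /forallP M12] := mM.
  have zM : 0 \in cover M by rewrite covM inE ffunE inE.
  have := pblock_mem zM; set S := pblock M 0 => SM.
  have zS : 0 \in S by rewrite mem_pblock.
  rewrite (Binv x y M S) ?xy //.
  have : S \in [:: [set 0]; [set 0; 1]; [set 0; 2%R]].
    have /implyP/(_ SM) := M12 S; clear -zS.
    rewrite !inE => /orP[/cards1P[i Si]|].
      by move: zS; rewrite Si inE => /eqP->; rewrite eqxx.
    rewrite (cardsD1 0) zS => /cards1P[i Si].
    have : i \in S :\ 0 by rewrite Si inE.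
    rewrite -(setD1K zS) Si !inE => /andP[i0 _].
    case: i i0 {Si} => -[|[|[|//]]] i //= _.
      by apply/or3P; apply: Or32; apply/eqP; congr [set _; _]; apply: val_inj.
    by apply/or3P; apply: Or33; apply/eqP; congr [set _; _]; apply: val_inj.
  rewrite !inE => /or3P[]/eqP->; have := Bge0 [set 0] M mM;
    have := Bge0 [set 0; 1] M mM; have := Bge0 [set 0; 2%R] M mM; clear; lra.
apply: le_trans le _; rewrite /T !flip_bv3 !inE /= !addbT !addbF !negbK.
by clear; lra.
Qed.

(* [a], ..., [f] are the weights of the edges of K4 on [p], [q], [r], [t]. *)
Lemma K4_degrees_sorted (p q r t : rat) : 0 <= t ->
  q <= p -> r <= p -> t <= q -> t <= r -> p <= q + r + t ->
  exists a b c d e f : rat,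
    [/\ [&& 0 <= a, 0 <= b, 0 <= c, 0 <= d, 0 <= e & 0 <= f],
        p = a + b + c, q = a + d + e, r = b + d + f & t = c + e + f].
Proof.
(* All of [t] goes to its edge with [p]; [h] is then the weight of the edge [q]-[r] in the triangle
   with degrees [p - t], [q], [r]. *)
move=> t0 qp rp tq tr le; pose h := (q + r + t - p) / 2.
have hE : h * 2 = q + r + t - p by rewrite divfK.
by exists (q - h), (r - h), t, h, 0, 0; split; lra.
Qed.

(** The vertices are relabelled to make [t] smallest and [p] largest; the witnesses permute the six
    edges accordingly. *)
Lemma K4_degrees (p q r t : rat) : 0 <= p -> 0 <= q -> 0 <= r -> 0 <= t ->
  p <= q + r + t -> q <= p + r + t -> r <= p + q + t -> t <= p + q + r ->
  exists a b c d e f : rat,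
    [/\ [&& 0 <= a, 0 <= b, 0 <= c, 0 <= d, 0 <= e & 0 <= f],
        p = a + b + c, q = a + d + e, r = b + d + f & t = c + e + f].
Proof.
move=> p0 q0 r0 t0 hp hq hr ht.
wlog tmin : p q r t p0 q0 r0 t0 hp hq hr ht / [&& t <= p, t <= q & t <= r].
  move=> wl; case: (boolP [&& t <= p, t <= q & t <= r]) => [|H].
    exact: wl.
  case: (boolP [&& p <= q, p <= r & p <= t]) => [Hp|H'].
    have [|||||||||a [b [c [d [e [f [pos E1 E2 E3 E4]]]]]]] :=
      wl t q r p; try lra.
    exists e, f, c, d, a, b; split; lra.
  case: (boolP [&& q <= p, q <= r & q <= t]) => [Hq|H''].
    have [|||||||||a [b [c [d [e [f [pos E1 E2 E3 E4]]]]]]] :=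
      wl p t r q; try lra.
    exists c, b, a, f, e, d; split; lra.
  have [|||||||||a [b [c [d [e [f [pos E1 E2 E3 E4]]]]]]] :=
      wl p q t r; try lra.
    exists a, c, b, e, d, f; split; lra.
case/and3P: tmin => tp tq tr.
have [qp|/ltW pq] := lerP q p.
  have [rp|/ltW pr] := lerP r p; first exact: K4_degrees_sorted.
  have [|||||a [b [c [d [e [f [pos E1 E2 E3 E4]]]]]]] :=
      @K4_degrees_sorted r q p t t0; try lra.
  exists d, b, f, a, e, c; split; lra.
have [rq|/ltW qr] := lerP r q.
  have [|||||a [b [c [d [e [f [pos E1 E2 E3 E4]]]]]]] :=
      @K4_degrees_sorted q p r t t0; try lra.
  exists a, d, e, b, c, f; split; lra.
have [|||||a [b [c [d [e [f [pos E1 E2 E3 E4]]]]]]] :=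
      @K4_degrees_sorted r q p t t0; try lra.
exists d, b, f, a, e, c; split; lra.
Qed.

(** These are the matchings of three indices that contain a pair; the one with three singletons will
    get weight 0. *)
Definition isolate (i : 'I_3) : {set {set 'I_3}} := [set [set i]; ~: [set i]].

Lemma is_match_isolate i : is_match (charv setT) (isolate i).
Proof.
have ci : #|~: [set i]| = 2%N by rewrite cardsC1 card_ord.
apply/andP; split; last first.
  by apply/forallP => S; apply/implyP; rewrite !inE => /orP[]/eqP->;
     rewrite ?cards1 ?ci.
apply/and3P; split.
- rewrite /cover bigcup_setU !big_set1 setUCr; apply/eqP/setP => j.
  by rewrite !inE ffunE inE.
- apply/trivIsetP => A B; rewrite !inE => /orP[]/eqP-> /orP[]/eqP->;
    rewrite ?eqxx // => _.
    by rewrite -setI_eq0 setICr.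
  by rewrite -setI_eq0 setIC setICr.
by rewrite !inE negb_or !(eq_sym set0) -!card_gt0 cards1 ci.
Qed.

Section SingleBlock.
Variable J : finType.

(** Removing [set0] yields the empty partition when [z] is zero. *)
Definition single_block (z : bvec J) : {set {set J}} :=
  [set [set j | z j]] :\ set0.

Lemma in_single_block (z : bvec J) S :
  S \in single_block z -> S = [set j | z j].
Proof. by rewrite !inE => /andP[_ /eqP]. Qed.

Lemma is_match_single_block (z : bvec J) : (#|[set j | z j]| <= 2)%N ->
  is_match z (single_block z).
Proof.
move=> le2; apply/andP; split; last first.
  apply/forallP => S; apply/implyP => SM.
  have := SM; rewrite !inE -card_gt0 => /andP[S0 _]; move: S0.
  by rewrite (in_single_block SM); case: #|_| le2 => [|[|[|]]].
apply/and3P; split.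
- apply/eqP; rewrite /single_block.
  case: (eqVneq [set j | z j] set0) => [->|z0].
    by rewrite setDv /cover big_set0.
  suff -> : [set [set j | z j]] :\ set0 = [set [set j | z j]].
    by rewrite /cover big_set1.
  by apply/setP => S; rewrite !inE andbC; case: eqP => // ->.
- by apply/trivIsetP => A B /in_single_block-> /in_single_block->; rewrite eqxx.
by rewrite !inE eqxx.
Qed.

End SingleBlock.

Lemma sum_indicator (J : finType) (z : bvec J) M0 (r : rat) : is_match z M0 ->
  \sum_(M | is_match z M) (M == M0)%:R * r = r.
Proof.
move=> mM; rewrite (bigD1 M0) //= eqxx mul1r big1 ?addr0 //.
move=> M /andP[_ /negPf->].
by rewrite mul0r.
Qed.

Lemma charv_setT (J : finType) (z : bvec J) : [set j | z j] = setT ->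
  z = charv setT.
Proof.
by move/setP => zT; apply/ffunP => j; have := zT j; rewrite !ffunE !inE.
Qed.

Lemma cond2_windable (F : bvec 'I_3 -> rat) : (forall x, 0 <= F x) ->
  cond2 F -> windable F.
Proof.
move=> F0 Fle.
(* An antipodal pair is named by the parities [u], [v] of its first coordinate with the second and
   the third. *)
pose P u v := F (bv3 false u v) * F (bv3 true (~~ u) (~~ v)).
have P0 u v : 0 <= P u v by rewrite mulr_ge0.
have PE a b c : F (bv3 a b c) * F (bv3 (~~ a) (~~ b) (~~ c)) =
    P (a (+) b) (a (+) c).
  by case: a => //; rewrite /P mulrC !addTb !negbK.
have Ple u v : P u v <= P u (~~ v) + P (~~ u) v + P (~~ u) (~~ v).
  by have := Fle false u v; rewrite /P /= !negbK.
have [||||a [b [c [d [e [f [pos E1 E2 E3 E4]]]]]]] :=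
  K4_degrees (P0 false false) (P0 false true) (P0 true false) (P0 true true).
- by have := Ple false false.
- by have := Ple false true; rewrite /=; clear; lra.
- by have := Ple true false; rewrite /=; clear; lra.
- by have := Ple true true; rewrite /=; clear; lra.
(* Flipping coordinate [i] pairs up the four vertices of K4 by two disjoint edges; the parity of the
   other two coordinates tells which edge contains the vertex of [x]. *)
pose alpha (i : 'I_3) (x : bvec 'I_3) : rat :=
  nth 0 [:: if x 1 (+) x 2%R then d else c; if x 0 (+) x 2%R then e else b;
            if x 0 (+) x 1 then f else a] i.
have alpha0 i x : 0 <= alpha i x.
  by case/and5P: pos => ? ? ? ? /andP[? ?];
     case: i => -[|[|[|//]]] i; rewrite /alpha /=; case: ifP.
have alphaS i (S : {set 'I_3}) x : S \in isolate i ->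
    alpha i (bxor x (charv S)) = alpha i x.
  (* A block of [isolate i] contains both or neither of the other two indices, so flipping it keeps
     their parity. *)
  move=> SM; have SE : exists s, forall j, (j \in S) = (j == i) (+) s.
    move: SM; rewrite !inE => /orP[]/eqP->; [exists false|exists true] => j;
      by rewrite !inE ?addbF ?addbT.
  have [s {}SE] := SE; case: i SE {SM} => -[|[|[|//]]] i SE;
    rewrite /alpha /= !ffunE !SE /=;
    by rewrite addbACA addbb addbF.
have alphaP x y : bxor x y = charv setT -> F x * F y = \sum_i alpha i x.
  move=> /ffunP xy; have yE j : y j = ~~ x j.
    by have := xy j; rewrite !ffunE inE; case: (x j); case: (y j).
  rewrite (bv3E x) (bv3E y) !yE PE !big_ord_recl big_ord0 /alpha /= !ffunE /=.
  case: (x 0); case: (x 1); case: (x 2%R) => /=; rewrite ?E1 ?E2 ?E3 ?E4; ring.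
(* If [x] and [y] are not antipodal, the whole product goes to the matching with at most one block;
   flipping that block swaps [x] and [y]. *)
exists (fun x y M => if [set j | bxor x y j] == setT
  then \sum_i (M == isolate i)%:R * alpha i x
  else (M == single_block (bxor x y))%:R * (F x * F y)); split.
- move=> x y M _; case: ifP => _; last by rewrite !mulr_ge0 ?ler0n.
  by rewrite sumr_ge0 // => i _; rewrite mulr_ge0 ?ler0n.
- move=> x y; case: eqP => [/charv_setT xy|/eqP xy].
    rewrite exchange_big (alphaP _ _ xy) /=; apply: eq_bigr => i _.
    by rewrite xy sum_indicator // is_match_isolate.
  rewrite sum_indicator // is_match_single_block //.
  have: [set j | bxor x y j] \proper setT by rewrite properT.
  by move/proper_card; rewrite cardsT card_ord.
move=> x y M S mM SM.
have -> : bxor (bxor x (charv S)) (bxor y (charv S)) = bxor x y.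
  by apply/ffunP => i; rewrite !ffunE addbACA addbb addbF.
case: ifP => _.
  apply: eq_bigr => i _; case: eqP => [Mi|]; last by rewrite !mul0r.
  by rewrite alphaS -?Mi.
case: eqP => [Ms|]; last by rewrite !mul0r.
have /in_single_block SE : S \in single_block (bxor x y) by rewrite -Ms.
have -> : bxor x (charv S) = y.
  by apply/ffunP => i; rewrite !ffunE SE inE ffunE addbA addbb.
have -> : bxor y (charv S) = x.
  by apply/ffunP => i; rewrite !ffunE SE inE ffunE addbCA addbb addbF.
by rewrite [F y * _]mulrC.
Qed.

Theorem theorem4 (F : bvec 'I_3 -> rat) (F_nonneg : forall x, 0 <= F x) :
  (windable F <-> cond2 F) /\ (cond2 F <-> has_matchings_circuit F).
Proof.
split; split.
- exact: windable_cond2.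
- exact: cond2_windable.
- exact: cond2_circuit.
exact: circuit_cond2.
Qed.
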